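(* Let $T>0$, $A\in\mathbb{R}^{n\times n}$, $B\in\mathbb{R}^{n\times m}$, $x_0\in\mathbb{R}^n$, let $K(x,u)$ be a strictly convex (differentiable) function of $(x,u)\in\mathbb{R}^n\times\mathbb{R}^m$, and let $X,U,P$ be positive definite (symmetric) weighting matrices of sizes $n\times n$, $m\times m$, $n\times n$. Let $(x_*(t),u_*(t),p_*(t))$, $t\in[0,T]$, satisfy $$\dot x_*=Ax_*+Bu_*,\ x_*(0)=x_0;\qquad 0=B^\top p_*+\frac{\partial K}{\partial u}(x_*,u_* );\qquad \dot p_*=-A^\top p_*-\frac{\partial K}{\partial x}(x_*,u_* ),\ p_*(T)=0,$$ and set $z_*=Xx_*$, $v_*=Uu_*$, $r_*=Pp_*$. Define $$\widetilde{\mathcal H}(z,v,r)=\frac12\int_0^T\Big[(z-z_* )^\top X^{-1}(z-z_* )+(v-v_* )^\top U^{-1}(v-v_* )+(r-r_* )^\top P^{-1}(r-r_* )\Big]dt .$$ Consider the system of partial differential equations in $t\in[0,T]$ and $\tau\ge 0$ $$\frac{\partial}{\partial\tau}\begin{bmatrix} z\\ v\\ r\end{bmatrix}=\begin{bmatrix}0&0&-\frac{\partial}{\partial t}-A^\top\\ 0&0&-B^\top\\ -\frac{\partial}{\partial t}+A&B&0\end{bmatrix}\begin{bmatrix}\frac{\delta\widetilde{\mathcal H}}{\delta z}\\ \frac{\delta\widetilde{\mathcal H}}{\delta v}\\ \frac{\delta\widetilde{\mathcal H}}{\delta r}\end{bmatrix}-\begin{bmatrix}\frac{\partial K}{\partial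 x}(x,u)-\frac{\partial K}{\partial x}(x_*,u_* )\\ \frac{\partial K}{\partial u}(x,u)-\frac{\partial K}{\partial u}(x_*,u_* )\\ 0\end{bmatrix},$$ where $x=X^{-1}z$, $u=U^{-1}v$, $p=P^{-1}r$, with boundary conditions $x(0,\tau)=x_0$ and $p(T,\tau)=0$. Assume that the pair $(A,B)$ is controllable. Then the largest invariant set contained in $$\Big\{(z(t,\tau),v(t,\tau),r(t,\tau)),\ t\in[0,T]\ \Big|\ \frac{d}{d\tau}\widetilde{\mathcal H}=0\Big\}$$ is equal to the single function $(z_*(t),v_*(t),r_*(t))$, $t\in[0,T]$.
   Context: Here $t\in[0,T]$ is physical time and $\tau\in[0,\infty)$ is algorithmic time; $z,v,r$ (equivalently $x,u,p$) are vector-valued functions of $(t,\tau)$, while the starred functions depend on $t$ only. The system is viewed as a dynamical system evolving in $\tau$, whose state at algorithmic time $\tau$ is the triple of functions of $t\in[0,T]$ given by $(z(\cdot,\tau),v(\cdot,\tau),r(\cdot,\tau))$. The variational derivatives are $\frac{\delta\widetilde{\mathcal H}}{\delta z}=X^{-1}(z-z_* )=x-x_*$, $\frac{\delta\widetilde{\mathcal H}}{\delta v}=U^{-1}(v-v_* )=u-u_*$, $\frac{\delta\widetilde{\mathcal H}}{\delta r}=P^{-1}(r-r_* )=p-p_*$. The quantity $\frac{d}{d\tau}\widetilde{\mathcal H}$ is the derivative of $\widetilde{\mathcal H}$ along the $\tau$-dynamics. ''Invariant'' is meant with respect to the $\tau$-dynamics, in the usual sense of LaSalle's invariance principle. No particular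 function spaces or solution concept are specified; the statement is at the level of a formal LaSalle analysis. The triple $(x_*,u_*,p_* )$ is the solution given by Pontryagin's minimum principle for minimizing $\int_0^T K(x(t),u(t))\,dt$ subject to $\dot x=Ax+Bu$, $x(0)=x_0$. The pair $(A,B)$ is controllable if $\operatorname{rank}[B\ AB\ \cdots\ A^{n-1}B]=n$. *)

(* Defs.v *)
From HB Require Import structures.
From mathcomp Require Import all_boot all_order all_algebra.
From mathcomp Require Import all_classical all_reals all_analysis.

Set Implicit Arguments.
Unset Strict Implicit.
Unset Printing Implicit Defensive.

Import Order.TTheory GRing.Theory Num.Theory.
Import numFieldNormedType.Exports.

Local Open Scope classical_set_scope.
Local Open Scope ring_scope.

Section LinearAlgebra.
Variable R : realType.

Definition qform k (M : 'M[R]_k) (y : 'cV[R]_k) : R := (y^T *m M *m y) 0 0.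

Definition posdefmx k (M : 'M[R]_k) : Prop :=
  M^T = M /\ forall y : 'cV[R]_k, y != 0 -> 0 < qform M y.

Definition controllable n m (A : 'M[R]_n) (B : 'M[R]_(n, m)) : Prop :=
  \rank (\mxrow_(j < n) (A ^+ j *m B)) = n.

End LinearAlgebra.

Section Calculus.
Variable R : realType.

Definition strictly_convex (E : lmodType R) (f : E -> R) : Prop :=
  forall (a : R) (y w : E), y != w -> 0 < a < 1 ->
    f (a *: y + (1 - a) *: w) < a * f y + (1 - a) * f w.

Definition grad_x n m (K : 'cV[R]_n * 'cV[R]_m -> R) (x : 'cV[R]_n)
    (u : 'cV[R]_m) : 'cV[R]_n :=
  \col_i 'D_(delta_mx i 0) (fun y => K (y, u)) x.

Definition grad_u n m (K : 'cV[R]_n * 'cV[R]_m -> R) (x : 'cV[R]_n)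
    (u : 'cV[R]_m) : 'cV[R]_m :=
  \col_i 'D_(delta_mx i 0) (fun w => K (x, w)) u.

(* Derivative of f at a relative to D: only points of D enter the difference
   quotient, so that it is one-sided at an end point of an interval D. *)
Definition diff_quot (V : normedModType R) (f : R -> V) (a b : R) : V :=
  (b - a)^-1 *: (f b - f a).

Definition derivable_in (V : normedModType R) (D : set R) (f : R -> V) (a : R)
    : Prop :=
  cvg (diff_quot f a @ within D a^').

Definition deriv_in (V : normedModType R) (D : set R) (f : R -> V) (a : R) : V :=
  lim (diff_quot f a @ within D a^').

End Calculus.

(* Functions of t in [0, T] are represented by functions on R whose values
   outside [0, T] are irrelevant; accordingly, equality of states is eq_state. *)
Record state (R : realType) (n m : nat) := State {
  sz : R -> 'cV[R]_n;
  sv : R -> 'cV[R]_m;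
  sr : R -> 'cV[R]_n
}.

Section System.
Variables (R : realType) (n m : nat).
Variables (T : R) (A : 'M[R]_n) (B : 'M[R]_(n, m)) (x0 : 'cV[R]_n).
Variable K : 'cV[R]_n * 'cV[R]_m -> R.
Variables (X : 'M[R]_n) (U : 'M[R]_m) (P : 'M[R]_n).
Variables (xs : R -> 'cV[R]_n) (us : R -> 'cV[R]_m) (ps : R -> 'cV[R]_n).

Let I : set R := [set t | 0 <= t <= T].
Let J : set R := [set tau | 0 <= tau].

Definition pontryagin : Prop :=
  [/\ forall t, I t ->
        derivable_in I xs t /\ deriv_in I xs t = A *m xs t + B *m us t,
      xs 0 = x0,
      forall t, I t -> 0 = B^T *m ps t + grad_u K (xs t) (us t),
      forall t, I t ->
        derivable_in I ps t /\
        deriv_in I ps t = - (A^T *m ps t) - grad_x K (xs t) (us t)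
    & ps T = 0].

Definition star : state R n m :=
  State (fun t => X *m xs t) (fun t => U *m us t) (fun t => P *m ps t).

Definition eq_state (s s' : state R n m) : Prop :=
  forall t, I t -> [/\ sz s t = sz s' t, sv s t = sv s' t & sr s t = sr s' t].

Definition Htilde (s : state R n m) : R :=
  2^-1 * \int[lebesgue_measure]_(t in I)
    (qform (invmx X) (sz s t - sz star t)
     + qform (invmx U) (sv s t - sv star t)
     + qform (invmx P) (sr s t - sr star t)).

(* Variational derivatives of Htilde. *)
Definition dHdz (s : state R n m) (t : R) := invmx X *m (sz s t - sz star t).
Definition dHdv (s : state R n m) (t : R) := invmx U *m (sv s t - sv star t).
Definition dHdr (s : state R n m) (t : R) := invmx P *m (sr s t - sr star t).

(* A trajectory maps the algorithmic time tau to a state. *)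
Implicit Type sigma : R -> state R n m.

Definition dtau_z sigma (t tau : R) := deriv_in J (fun h => sz (sigma h) t) tau.
Definition dtau_v sigma (t tau : R) := deriv_in J (fun h => sv (sigma h) t) tau.
Definition dtau_r sigma (t tau : R) := deriv_in J (fun h => sr (sigma h) t) tau.
Definition dt_z sigma (t tau : R) := deriv_in I (sz (sigma tau)) t.
Definition dt_r sigma (t tau : R) := deriv_in I (sr (sigma tau)) t.

Definition continuous_tt (V : normedModType R) (f : R -> R -> V) : Prop :=
  {within I `*` J, continuous (fun q : R * R => f q.1 q.2)}.

(* Regularity of a classical solution on [0, T] x [0, oo): every partial
   derivative occurring in the equations (v is never differentiated in t)
   exists and is jointly continuous. *)
Definition regular sigma : Prop :=
  [/\ forall t tau, I t -> J tau ->
        [/\ derivable_in J (fun h => sz (sigma h) t) tau,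
            derivable_in J (fun h => sv (sigma h) t) tau,
            derivable_in J (fun h => sr (sigma h) t) tau,
            derivable_in I (sz (sigma tau)) t
          & derivable_in I (sr (sigma tau)) t],
      [/\ continuous_tt (fun t tau => sz (sigma tau) t),
          continuous_tt (fun t tau => sv (sigma tau) t)
        & continuous_tt (fun t tau => sr (sigma tau) t)],
      [/\ continuous_tt (dtau_z sigma), continuous_tt (dtau_v sigma)
        & continuous_tt (dtau_r sigma)]
    & continuous_tt (dt_z sigma) /\ continuous_tt (dt_r sigma)].

Definition pde sigma : Prop :=
  forall t tau, I t -> J tau ->
  let s := sigma tau in
  let x := invmx X *m sz s t in
  let u := invmx U *m sv s t in
  [/\ dtau_z sigma t tau =
        - deriv_in I (dHdr s) t - A^T *m dHdr s t
        - (grad_x K x u - grad_x K (xs t) (us t)),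
      dtau_v sigma t tau =
        - (B^T *m dHdr s t) - (grad_u K x u - grad_u K (xs t) (us t))
    & dtau_r sigma t tau =
        - deriv_in I (dHdz s) t + A *m dHdz s t + B *m dHdv s t].

Definition boundary sigma : Prop :=
  forall tau, J tau ->
    invmx X *m sz (sigma tau) 0 = x0 /\ invmx P *m sr (sigma tau) T = 0.

Definition solution sigma : Prop :=
  [/\ regular sigma, pde sigma & boundary sigma].

(* The states met by solutions at instants where d/dtau Htilde vanishes. *)
Definition stationary_set : set (state R n m) :=
  [set s | exists sigma tau,
    [/\ solution sigma, J tau, eq_state (sigma tau) s,
        derivable_in J (fun h => Htilde (sigma h) : R^o) tau
      & deriv_in J (fun h => Htilde (sigma h) : R^o) tau = 0]].

(* As the well-posedness of the system is not presupposed, invariance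
   includes the existence of a global solution from each point of M;
   otherwise states without solution would be vacuously invariant. *)
Definition tau_invariant (M : set (state R n m)) : Prop :=
  forall s, M s ->
    (exists2 sigma, solution sigma & eq_state (sigma 0) s) /\
    (forall sigma, solution sigma -> eq_state (sigma 0) s ->
      forall tau, J tau -> M (sigma tau)).

Definition largest_invariant_in (E M : set (state R n m)) : Prop :=
  [/\ tau_invariant M, M `<=` E
    & forall M', tau_invariant M' -> M' `<=` E -> M' `<=` M].

End System.

(* Main.v *)
(** Write [xi], [eta], [rho] for the variational derivatives of [Htilde], that
    is, for the deviations of x, u, p from the optimal triple.  Along a solution,
    the skew part of the system contributes only [- [xi . rho]_0^T], which
    vanishes by the boundary conditions, so that d/dtau Htilde is minus the
    integral of [xi . (dK/dx - dK/dx* ) + eta . (dK/du - dK/du* )].  This integrand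
    is nonnegative, and zero only for [xi = eta = 0], by strict monotonicity of the
    gradient of the strictly convex function K.  Hence Htilde decreases along every
    solution, which makes the optimal triple invariant.  Conversely, on an invariant
    set contained in the stationary set z and v are constant in tau, so the first
    two equations reduce to [rho' = - A^T rho] and [B^T rho = 0]; differentiating
    the latter in t repeatedly, controllability forces [rho = 0].

    That the optimal triple is a classical solution at all needs the continuity
    of u* and of the gradient of K along it; neither is assumed, and both follow
    from convexity. *)

Require Import Defs.
From HB Require Import structures.
From mathcomp Require Import all_boot all_order all_algebra.
From mathcomp Require Import all_classical all_reals all_analysis.
From mathcomp Require Import ring lra.
Set Implicit Arguments.
Unset Strict Implicit.
Unset Printing Implicit Defensive.
Import Order.TTheory GRing.Theory Num.Theory.
Import numFieldNormedType.Exports.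
Local Open Scope classical_set_scope.
Local Open Scope ring_scope.

(** * Derivatives relative to a set *)

Section MatrixLimits.
Context {R : realType} {S : Type} {F : set_system S} {FF : Filter F}.

Lemma cvg_sumr (I : Type) (r : seq I) (f : I -> S -> R) (l : I -> R) :
  (forall i, f i s @[s --> F] --> l i) ->
  \sum_(i <- r) f i s @[s --> F] --> \sum_(i <- r) l i.
Proof.
move=> fl; elim: r => [|i r IHr].
  under eq_fun do rewrite big_nil.
  by rewrite big_nil; exact: cvg_cst.
under eq_fun do rewrite big_cons.
by rewrite big_cons; exact: cvgD.
Qed.

(** A ball of matrices is the product of the balls around its entries, and a filter is stable under
    the finite intersection over the indices. *)
Lemma cvg_mxP p q (f : S -> 'M[R]_(p, q)) (l : 'M[R]_(p, q)) :
  f s @[s --> F] --> l <-> forall i j, f s i j @[s --> F] --> l i j.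
Proof.
split=> [fl i j|fl].
  exact: (cvg_comp _ _ fl (@coord_continuous _ _ _ i j l)).
apply/cvg_ballP => e e0.
have H i j : \forall s \near F, ball (l i j) e (f s i j).
  by move/cvg_ballP : (fl i j); apply.
suff : \forall s \near F, forall i j, ball (l i j) e (f s i j).
  by apply: filterS => s ?; split.
by apply: filter_forall => i; apply: filter_forall => j; exact: H.
Qed.

Lemma cvg_mulmx p q r (f : S -> 'M[R]_(p, q)) (g : S -> 'M[R]_(q, r))
    (a : 'M[R]_(p, q)) (b : 'M[R]_(q, r)) :
  f s @[s --> F] --> a -> g s @[s --> F] --> b ->
  f s *m g s @[s --> F] --> a *m b.
Proof.
move=> /cvg_mxP fa /cvg_mxP gb; apply/cvg_mxP => i j.
under eq_fun do rewrite mxE.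
by rewrite mxE; apply: cvg_sumr => k; exact: cvgM.
Qed.

Lemma cvg_mulmxr p q r (M : 'M[R]_(p, q)) (g : S -> 'M[R]_(q, r))
    (b : 'M[R]_(q, r)) :
  g s @[s --> F] --> b -> M *m g s @[s --> F] --> M *m b.
Proof. by apply: cvg_mulmx; exact: cvg_cst. Qed.

Lemma cvg_trmx p q (f : S -> 'M[R]_(p, q)) (a : 'M[R]_(p, q)) :
  f s @[s --> F] --> a -> (f s)^T @[s --> F] --> a^T.
Proof.
move=> /cvg_mxP fa; apply/cvg_mxP => i j.
by under eq_fun do rewrite mxE; rewrite mxE; exact: fa.
Qed.

End MatrixLimits.
Arguments cvg_mulmxr {R S F FF p q r} M {g b}.

Section RelativeDerivative.
Context {R : realType}.

(** Existence and value of the derivative in one predicate: [deriv_in] is a [lim], which takes a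
    default value where there is no limit. *)
Definition has_deriv_in (V : normedModType R) (D : set R) (f : R -> V) (a : R)
  (l : V) : Prop := diff_quot f a b @[b --> within D a^'] --> l.

Lemma derivable_inP (V : normedModType R) (D : set R) (f : R -> V) a :
  derivable_in D f a -> has_deriv_in D f a (deriv_in D f a).
Proof. by []. Qed.

Lemma has_deriv_in_derivable (V : normedModType R) (D : set R) (f : R -> V) a l :
  has_deriv_in D f a l -> derivable_in D f a.
Proof. by move=> fl; apply/cvg_ex; exists l. Qed.

Lemma has_deriv_in_unique (V : normedModType R) (D : set R) (f : R -> V) a l :
  ProperFilter (within D a^') -> has_deriv_in D f a l -> deriv_in D f a = l.
Proof. by move=> PF fl; apply: cvg_lim => //; exact: norm_hausdorff. Qed.

(** Relative derivatives are unique only where [a] is a limit point of [D]; a segment in [D] issuing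
    from [a] guarantees this. *)
Lemma segment_within_dnbhs_proper (D : set R) (a c : R) :
  c != a -> (forall s, 0 <= s <= 1 -> D (a + s * (c - a))) ->
  ProperFilter (within D a^').
Proof.
move=> ca Dac; apply: Build_ProperFilter_ex => // Q.
move=> /nbhs_ballP[e /= e0 eQ].
(* The cap 1 keeps the point on the segment; the second term keeps it within [e / 2] of [a]. *)
pose s := Num.min 1 (e / 2 / `|c - a|).
have ca0 : 0 < `|c - a| by rewrite normr_gt0 subr_eq0.
have s0 : 0 < s by rewrite lt_min ltr01 !divr_gt0.
exists (a + s * (c - a)); apply: eQ.
- rewrite /ball /= opprD addrA subrr sub0r normrN normrM gtr0_norm//.
  have : s <= e / 2 / `|c - a| by rewrite ge_min lexx orbT.
  rewrite ler_pdivlMr// => /le_lt_trans; apply.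
  by rewrite ltr_pdivrMr// ltr_pMr// ltr1n.
- by rewrite -subr_eq0 addrAC subrr add0r mulf_neq0 ?subr_eq0// gt_eqF.
- by apply: Dac; rewrite ltW//= ge_min lexx.
Qed.

(** Values outside [D] never enter the quotient; [D a] is there because [f a] does. *)
Lemma eq_has_deriv_in (V : normedModType R) (D : set R) (f g : R -> V) a l :
  D a -> (forall b, D b -> f b = g b) ->
  has_deriv_in D f a l -> has_deriv_in D g a l.
Proof.
move=> Da fg; apply: cvg_trans; apply: near_eq_cvg.
rewrite near_withinE; apply: nearW => b Db.
by rewrite /diff_quot !fg.
Qed.

Lemma has_deriv_in_cst (V : normedModType R) (D : set R) (k : V) a :
  has_deriv_in D (fun=> k) a 0.
Proof.
rewrite /has_deriv_in /diff_quot; under eq_fun do rewrite subrr scaler0.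
exact: cvg_cst.
Qed.

Lemma has_deriv_inD (V : normedModType R) (D : set R) (f g : R -> V) a k l :
  has_deriv_in D f a k -> has_deriv_in D g a l ->
  has_deriv_in D (fun b => f b + g b) a (k + l).
Proof.
move=> fk gl; rewrite /has_deriv_in.
have -> : diff_quot (fun b => f b + g b) a =
          fun b => diff_quot f a b + diff_quot g a b.
  by apply/funext => b; rewrite /diff_quot -scalerDr opprD addrACA.
exact: cvgD.
Qed.

Lemma has_deriv_inB (V : normedModType R) (D : set R) (f g : R -> V) a k l :
  has_deriv_in D f a k -> has_deriv_in D g a l ->
  has_deriv_in D (fun b => f b - g b) a (k - l).
Proof.
move=> fk gl; rewrite /has_deriv_in.
have -> : diff_quot (fun b => f b - g b) a =
          fun b => diff_quot f a b - diff_quot g a b.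
  by apply/funext => b; rewrite /diff_quot -scalerBr !opprD opprK addrACA.
exact: cvgB.
Qed.

(** For [b != a], [f b] is [(b - a)] times the difference quotient plus [f a], and the first term
    tends to 0. *)
Lemma has_deriv_in_dcvg (V : normedModType R) (D : set R) (f : R -> V) a l :
  has_deriv_in D f a l -> f b @[b --> within D a^'] --> f a.
Proof.
move=> fl.
have H : (b - a) *: diff_quot f a b + f a @[b --> within D a^'] --> f a.
  rewrite -[X in _ --> X]add0r -[X in _ --> X + _](scale0r l).
  apply: cvgD; last exact: cvg_cst.
  apply: cvgZ => //.
  rewrite -(subrr a); apply: cvgB; last exact: cvg_cst.
  by apply: cvg_within_filter; exact: nbhs_dnbhs.
apply: cvg_trans H; apply: near_eq_cvg.
rewrite near_withinE; near=> b => _.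
rewrite /diff_quot scalerA divff ?scale1r ?subrK//.
by rewrite subr_eq0; near: b; exact: nbhs_dnbhs_neq.
Unshelve. all: by end_near. Qed.

Lemma has_deriv_in_cvg (V : normedModType R) (D : set R) (f : R -> V) a l :
  has_deriv_in D f a l -> f b @[b --> within D (nbhs a)] --> f a.
Proof.
move=> /has_deriv_in_dcvg fa Q Qfa.
have : nbhs a (fun b => b != a -> D b -> Q (f b)) := fa _ Qfa.
rewrite -[X in _ -> X]/(nbhs a (fun b => D b -> Q (f b))).
apply: filterS => b H Db; have [->|/H] := eqVneq b a; last exact.
exact: nbhs_singleton.
Qed.

(** Product rule with the order of the factors kept: the increment of the product splits as
    [(f b - f a) *m g b + f a *m (g b - g a)]. *)
Lemma has_deriv_in_mulmx (D : set R) p q r (f : R -> 'M[R]_(p, q))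
    (g : R -> 'M[R]_(q, r)) a k l :
  has_deriv_in D f a k -> has_deriv_in D g a l ->
  has_deriv_in D (fun b => f b *m g b) a (k *m g a + f a *m l).
Proof.
move=> fk gl; rewrite /has_deriv_in.
have -> : diff_quot (fun b => f b *m g b) a =
          fun b => diff_quot f a b *m g b + f a *m diff_quot g a b.
  apply/funext => b; rewrite /diff_quot -scalemxAl -scalemxAr -scalerDr.
  by rewrite mulmxBl mulmxBr addrA subrK.
apply: cvgD; apply: cvg_mulmx => //; last exact: cvg_cst.
exact: has_deriv_in_dcvg gl.
Qed.

Lemma has_deriv_in_mulmxr (D : set R) p q r (M : 'M[R]_(p, q))
    (g : R -> 'M[R]_(q, r)) a l :
  has_deriv_in D g a l -> has_deriv_in D (fun b => M *m g b) a (M *m l).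
Proof.
move=> gl; have := has_deriv_in_mulmx (has_deriv_in_cst D M a) gl.
by rewrite mul0mx add0r.
Qed.

Lemma has_deriv_in_trmx (D : set R) p q (f : R -> 'M[R]_(p, q)) a k :
  has_deriv_in D f a k -> has_deriv_in D (fun b => (f b)^T) a k^T.
Proof.
move=> fk; rewrite /has_deriv_in.
have -> : diff_quot (fun b => (f b)^T) a = fun b => (diff_quot f a b)^T.
  by apply/funext => b; apply/matrixP => i j; rewrite /diff_quot !mxE.
exact: cvg_trmx.
Qed.

Lemma has_deriv_in_entry (D : set R) p q (f : R -> 'M[R]_(p, q)) a k i j :
  has_deriv_in D f a k -> has_deriv_in D (fun b => f b i j : R) a (k i j).
Proof.
move=> fk; rewrite /has_deriv_in.
have -> : diff_quot (fun b => f b i j : R) a = fun b => diff_quot f a b i j.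
  by apply/funext => b; rewrite /diff_quot !mxE.
by move/cvg_mxP : fk; exact.
Qed.

(** At an interior point of [D] the restriction to [D] is invisible. This gives access to the mean
    value theorem and the fundamental theorem of calculus. *)
Lemma has_deriv_in_is_derive (D : set R) (f : R -> R) a l :
  nbhs a D -> has_deriv_in D f a l -> is_derive a 1 f l.
Proof.
move=> nD fl.
have H : h^-1 *: ((f \o shift a) (h *: 1) - f a) @[h --> 0^'] --> l.
  have -> : (fun h : R => h^-1 *: ((f \o shift a) (h *: (1 : R)) - f a)) =
            diff_quot f a \o shift a.
    by apply/funext => h; rewrite /diff_quot /= addrK [h *: 1]mulr1.
  suff sh : shift a h @[h --> 0^'] --> within D a^' by exact: cvg_comp sh fl.
  move=> Q aQ.
  have {}aQ : nbhs a [set t | t != a -> D t -> Q t] := aQ.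
  have : nbhs a (D `&` [set t | t != a -> D t -> Q t]) by exact: filterI.
  move=> /nbhs_ballP[e /= e0 eQ].
  apply/nbhs_ballP; exists e => //= h; rewrite /ball/= sub0r normrN => he h0.
  have [|Dh] := eQ (h + a); first by rewrite /ball /= opprD addrCA subrr addr0 normrN.
  by apply => //; rewrite -subr_eq0 addrK.
by apply: DeriveDef; [apply/cvg_ex; exists l| apply: cvg_lim].
Qed.
End RelativeDerivative.
Arguments has_deriv_in_mulmxr {R D p q r} M {g a l}.

(** * Convex functions and their gradients *)

Section Convexity.
Context {R : realType} {E : normedModType R} (f : E -> R).
Hypothesis f_convex : strictly_convex f.
Hypothesis f_diff : forall a, differentiable f a.

(** The weak inequality also covers the degenerate cases [s = 0], [s = 1] and [v = 0], which the
    strict one excludes. *)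
Lemma strictly_convex_le (s : R) (a v : E) :
  0 <= s <= 1 -> f (s *: v + a) <= s * f (v + a) + (1 - s) * f a.
Proof.
move=> /andP[]; rewrite le_eqVlt => /predU1P[<- _|s0].
  by rewrite scale0r add0r mul0r add0r subr0 mul1r.
rewrite le_eqVlt => /predU1P[->|s1].
  by rewrite scale1r subrr mul0r addr0 mul1r.
have [->|v0] := eqVneq v 0.
  by rewrite scaler0 add0r -mulrDl addrC subrK mul1r.
have -> : s *: v + a = s *: (v + a) + (1 - s) *: a.
  by rewrite scalerDr scalerBl scale1r -addrA [s *: a + _]addrC subrK.
apply/ltW/f_convex; last by rewrite s0.
by rewrite -subr_eq0 addrK.
Qed.

(** By convexity the difference quotient is nondecreasing in the step, so its limit at [0^'+] lies
    below its value at [h]. *)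
Lemma derive_le_quotient (a v : E) (h : R) :
  0 < h -> 'D_v f a <= h^-1 * (f (h *: v + a) - f a).
Proof.
move=> h0.
have dv : h^-1 *: ((f \o shift a) (h *: v) - f a) @[h --> 0^'] --> 'D_v f a.
  exact: (diff_derivable (f_diff a)).
apply: (cvgr_to_le (cvg_dnbhs_at_right dv)).
near=> k.
have k0 : 0 < k by near: k; exact: nbhs_right_gt.
have kh : k <= h by near: k; exact: nbhs_right_le.
(* The point at step [k] is the convex combination, with weight [k / h], of the point at step [h]
   and of [a]. *)
have /(strictly_convex_le a (h *: v)) : 0 <= k / h <= 1.
  by apply/andP; split; [rewrite divr_ge0// ltW|rewrite ler_pdivrMr// mul1r].
rewrite scalerA divfK ?gt_eqF// => H.
rewrite [leLHS]/= -[X in X <= _]/(k^-1 * (f (k *: v + a) - f a)).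
rewrite ler_pdivrMl// mulrA.
by move: H; set F1 := f _; set F2 := f _; set F3 := f _; lra.
Unshelve. all: by end_near. Qed.

(** The derivative is at most the quotient at step 1/2, which strict convexity at the midpoint puts
    strictly below the quotient at step 1. *)
Lemma derive_lt_increment (a b : E) : a != b -> 'D_(b - a) f a < f b - f a.
Proof.
move=> ab; have half0 : (0 : R) < 2^-1 by rewrite invr_gt0.
have := derive_le_quotient a (b - a) half0; move=> /le_lt_trans; apply.
have half1 : (2^-1 : R) < 1 by lra.
have ba : b != a by rewrite eq_sym.
have := @f_convex 2^-1 _ _ ba; rewrite half0 half1 => /(_ isT).
have -> : 2^-1 *: b + (1 - 2^-1) *: a = 2^-1 *: (b - a) + a.
  by rewrite scalerBr scalerBl scale1r -!addrA [- _ + a]addrC.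
by set F1 := f _; set F2 := f _; set F3 := f _; rewrite invrK; lra.
Qed.

(** As a function of the base point, a directional derivative is the infimum over [h > 0] of
    continuous quotients, hence upper semicontinuous. Since the differential is linear, the same
    bound in direction [- v] gives lower semicontinuity. *)
Lemma continuous_derive (v : E) : continuous (fun a => 'D_v f a).
Proof.
have fc : continuous f by move=> a; exact: differentiable_continuous.
have up w a (e : R) : 0 < e -> \forall b \near a, 'D_w f b < 'D_w f a + e.
  move=> e0.
  have dv : h^-1 *: ((f \o shift a) (h *: w) - f a) @[h --> 0^'] --> 'D_w f a.
    exact: (diff_derivable (f_diff a)).
  (* The step [h] is fixed from the quotient at [a]; afterwards only the base point moves. *)
  have [h [h0 hlt]] : exists h : R, 0 < h /\
      h^-1 * (f (h *: w + a) - f a) < 'D_w f a + e.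
    near (0 : R)^'+ => h; exists h; split; first by near: h; exact: nbhs_right_gt.
    near: h; apply: (cvgr_lt ('D_w f a) (cvg_dnbhs_at_right dv)).
    by rewrite ltrDl.
  have qc : h^-1 * (f (h *: w + b) - f b) @[b --> a] -->
            h^-1 * (f (h *: w + a) - f a).
    apply: cvgM; first exact: cvg_cst.
    apply: cvgB; last exact: fc.
    apply: (@cvg_comp _ _ _ (fun b => h *: w + b) f); last exact: fc.
    by apply: cvgD; [exact: cvg_cst|exact: cvg_id].
  near=> b; apply: (le_lt_trans (derive_le_quotient b w h0)).
  by near: b; exact: cvgr_lt hlt.
move=> a; apply/cvgrPdist_lt => e e0.
near=> b.
have H1 : 'D_v f b < 'D_v f a + e by near: b; exact: up.
have : 'D_(- v) f b < 'D_(- v) f a + e by near: b; exact: up.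
move: H1; rewrite !deriveE// !linearN/= => H1 H2.
by rewrite ltr_norml; apply/andP; split; lra.
Unshelve. all: by end_near. Qed.

End Convexity.

(** * Inner product of column vectors *)

Definition dotv {R : realType} k (a b : 'cV[R]_k) : R := (a^T *m b) 0 0.

Section Dot.
Context {R : realType}.

Lemma dotvE k (a b : 'cV[R]_k) : dotv a b = \sum_i a i 0 * b i 0.
Proof. by rewrite /dotv mxE; apply: eq_bigr => i _; rewrite mxE. Qed.

Lemma dotvC k (a b : 'cV[R]_k) : dotv a b = dotv b a.
Proof. by rewrite !dotvE; apply: eq_bigr => i _; rewrite mulrC. Qed.

Lemma dotvDl k (a b c : 'cV[R]_k) : dotv (a + b) c = dotv a c + dotv b c.
Proof. by rewrite /dotv linearD /= mulmxDl mxE. Qed.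

Lemma dotvNl k (a b : 'cV[R]_k) : dotv (- a) b = - dotv a b.
Proof. by rewrite /dotv linearN /= mulNmx mxE. Qed.

Lemma dotvBl k (a b c : 'cV[R]_k) : dotv (a - b) c = dotv a c - dotv b c.
Proof. by rewrite dotvDl dotvNl. Qed.

Lemma dotvDr k (a b c : 'cV[R]_k) : dotv c (a + b) = dotv c a + dotv c b.
Proof. by rewrite /dotv mulmxDr mxE. Qed.

Lemma dotvNr k (a b : 'cV[R]_k) : dotv b (- a) = - dotv b a.
Proof. by rewrite /dotv mulmxN mxE. Qed.

Lemma dotvBr k (a b c : 'cV[R]_k) : dotv c (a - b) = dotv c a - dotv c b.
Proof. by rewrite dotvDr dotvNr. Qed.

Lemma dotvZr k (s : R) (a b : 'cV[R]_k) : dotv b (s *: a) = s * dotv b a.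
Proof. by rewrite /dotv -scalemxAr mxE. Qed.

Lemma dotv0r k (a : 'cV[R]_k) : dotv a 0 = 0.
Proof. by rewrite /dotv mulmx0 mxE. Qed.

Lemma dotv_mulmx k l (M : 'M[R]_(k, l)) (a : 'cV[R]_k) (b : 'cV[R]_l) :
  dotv a (M *m b) = dotv (M^T *m a) b.
Proof. by rewrite /dotv trmx_mul trmxK mulmxA. Qed.

Lemma cvg_dotv (S : Type) (F : set_system S) (FF : Filter F) k
    (f g : S -> 'cV[R]_k) (a b : 'cV[R]_k) :
  f s @[s --> F] --> a -> g s @[s --> F] --> b ->
  dotv (f s) (g s) @[s --> F] --> dotv a b.
Proof.
move=> fa gb; rewrite /dotv.
exact: ((cvg_mxP _ _).1 (cvg_mulmx (cvg_trmx fa) gb)).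
Qed.

Lemma has_deriv_in_dotv (D : set R) k (f g : R -> 'cV[R]_k) a df dg :
  has_deriv_in D f a df -> has_deriv_in D g a dg ->
  has_deriv_in D (fun b => dotv (f b) (g b) : R) a
    (dotv df (g a) + dotv (f a) dg).
Proof.
move=> fd gd.
have := has_deriv_in_entry (i := 0) (j := 0)
  (has_deriv_in_mulmx (has_deriv_in_trmx fd) gd).
by rewrite mxE.
Qed.

End Dot.

(** The norm is the maximum of the absolute values of the entries, so the sphere is a closed subset
    of a box; the box is compact as the transpose of a product of segments. *)
Lemma compact_sphere (R : realType) k (c : 'cV[R]_k) (e : R) : compact [set w | `|w - c| = e].
Proof.
pose box := [set v : 'rV[R]_k | forall i, `[c i 0 - e, c i 0 + e]%classic (v ord0 i)].
have cbox : compact box.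
  apply: (@rV_compact R k (fun i => `[c i 0 - e, c i 0 + e]%classic)) => i.
  exact: segment_compact.
have cb : compact [set v^T | v in box].
  apply: continuous_compact => //; apply: continuous_subspaceT => v.
  by apply: (@cvg_trmx _ _ (nbhs v)); exact: cvg_id.
apply: subclosed_compact cb _.
  apply: (@preimage_closed _ _ (fun w : 'cV[R]_k => `|w - c|) [set x | x = e]).
    move=> w _; exact: (cvg_norm (cvgB (@cvg_id _ (nbhs w)) (cvg_cst c))).
  exact: closed_eq.
move=> w /= we; exists w^T; last by rewrite trmxK.
move=> i; rewrite /= in_itv/= mxE.
have : `|(w - c) i 0| <= e.
  rewrite -we [leRHS]/Num.norm/= mx_normrE.
  exact: (le_bigmax 0 (fun ij : 'I_k * 'I_1 => `|(w - c) ij.1 ij.2|) (i, 0)).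
by rewrite !mxE ler_norml; lra.
Qed.

(** * Partial gradients of a strictly convex function on the product space *)

Section Gradient.
Context {R : realType} {n m : nat} (K : 'cV[R]_n * 'cV[R]_m -> R).
Hypothesis K_convex : strictly_convex K.
Hypothesis K_diff : forall q, differentiable K q.

Lemma grad_xE x u i : grad_x K x u i 0 = 'D_(delta_mx i 0, 0) K (x, u).
Proof.
rewrite mxE /derive; apply: (congr1 (fun g : R -> R => lim (g h @[h --> 0^']))).
apply/funext => h /=.
by rewrite -[h *: (delta_mx i 0, 0) + _]/(_, _) /= scaler0 add0r.
Qed.

Lemma grad_uE x u i : grad_u K x u i 0 = 'D_(0, delta_mx i 0) K (x, u).
Proof.
rewrite mxE /derive; apply: (congr1 (fun g : R -> R => lim (g h @[h --> 0^']))).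
apply/funext => h /=.
by rewrite -[h *: (0, delta_mx i 0) + _]/(_, _) /= scaler0 add0r.
Qed.

(** The differential is linear, and [(v, w)] decomposes along the canonical bases of the two
    factors. *)
Lemma derive_gradE x u v w :
  'D_(v, w) K (x, u) = dotv (grad_x K x u) v + dotv (grad_u K x u) w.
Proof.
have cE k (y : 'cV[R]_k) : y = \sum_i y i 0 *: delta_mx i 0.
  rewrite [LHS]matrix_sum_delta; apply: eq_bigr => i _.
  by rewrite big_ord_recl big_ord0 addr0.
have -> : (v, w) = \sum_i v i 0 *: (delta_mx i 0 : 'cV[R]_n, 0 : 'cV[R]_m)
                 + \sum_i w i 0 *: (0 : 'cV[R]_n, delta_mx i 0 : 'cV[R]_m).
  have inl (y z : 'cV[R]_n) : (y + z, 0 : 'cV[R]_m) = (y, 0) + (z, 0).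
    by rewrite -[RHS]/(_, _) /= addr0.
  have inr (y z : 'cV[R]_m) : (0 : 'cV[R]_n, y + z) = (0, y) + (0, z).
    by rewrite -[RHS]/(_, _) /= addr0.
  rewrite {1}(cE _ v) {1}(cE _ w).
  have -> (a : 'cV[R]_n) (b : 'cV[R]_m) : (a, b) = (a, 0) + (0, b).
    by rewrite -[RHS]/(_, _) /= addr0 add0r.
  rewrite (big_morph (fun y => (y, 0 : 'cV[R]_m)) inl (erefl _)).
  rewrite (big_morph (fun y => (0 : 'cV[R]_n, y)) inr (erefl _)).
  congr (_ + _); apply: eq_bigr => i _.
    by rewrite -[RHS]/(_, _) /= scaler0.
  by rewrite -[RHS]/(_, _) /= scaler0.
rewrite deriveE// linearD !linear_sum !dotvE /=; congr (_ + _);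
  apply: eq_bigr => i _.
- by rewrite linearZ grad_xE deriveE//= mulrC.
- by rewrite linearZ grad_uE deriveE//= mulrC.
Qed.

Lemma grad_lt_increment x u y w : (x, u) != (y, w) ->
  dotv (grad_x K x u) (y - x) + dotv (grad_u K x u) (w - u) < K (y, w) - K (x, u).
Proof.
move=> xu; rewrite -derive_gradE.
exact: (@derive_lt_increment _ _ K K_convex K_diff (x, u) (y, w)).
Qed.

(** Add the strict tangent inequalities at the two points: the increments of [K] cancel. *)
Lemma grad_monotone x u y w : (x, u) != (y, w) ->
  0 < dotv (y - x) (grad_x K y w - grad_x K x u)
    + dotv (w - u) (grad_u K y w - grad_u K x u).
Proof.
move=> xu; have yw : (y, w) != (x, u) by rewrite eq_sym.
have := grad_lt_increment xu; have := grad_lt_increment yw.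
rewrite !(dotvBr, dotvBl) !(dotvC (grad_x _ _ _)) !(dotvC (grad_u _ _ _)); lra.
Qed.

Lemma cvg_grad_x (S : Type) (F : set_system S) (FF : Filter F)
    (f : S -> 'cV[R]_n) (g : S -> 'cV[R]_m) (x : 'cV[R]_n) (u : 'cV[R]_m) :
  f s @[s --> F] --> x -> g s @[s --> F] --> u ->
  grad_x K (f s) (g s) @[s --> F] --> grad_x K x u.
Proof.
move=> fx gu; apply/cvg_mxP => i j; rewrite ord1.
under eq_fun do rewrite grad_xE.
rewrite grad_xE; apply: (@cvg_comp _ _ _ (fun s => (f s, g s))
  (fun q => 'D_(delta_mx i 0, 0) K q) F (nbhs (x, u))).
  exact: cvg_pair fx gu.
exact: continuous_derive.
Qed.

Lemma cvg_grad_u (S : Type) (F : set_system S) (FF : Filter F)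
    (f : S -> 'cV[R]_n) (g : S -> 'cV[R]_m) (x : 'cV[R]_n) (u : 'cV[R]_m) :
  f s @[s --> F] --> x -> g s @[s --> F] --> u ->
  grad_u K (f s) (g s) @[s --> F] --> grad_u K x u.
Proof.
move=> fx gu; apply/cvg_mxP => i j; rewrite ord1.
under eq_fun do rewrite grad_uE.
rewrite grad_uE; apply: (@cvg_comp _ _ _ (fun s => (f s, g s))
  (fun q => 'D_(0, delta_mx i 0) K q) F (nbhs (x, u))).
  exact: cvg_pair fx gu.
exact: continuous_derive.
Qed.

(* Legendre duality: [u t] is the minimiser of the strictly convex function
   [w |-> K (x t, w) - dotv (grad_u K (x t) (u t)) w], and near [t0] these
   functions are positive relative to [u t0] on a whole small sphere. *)
Lemma cvg_of_grad_u (D : set R) (x : R -> 'cV[R]_n) (u : R -> 'cV[R]_m) t0 :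
  x t @[t --> within D (nbhs t0)] --> x t0 ->
  grad_u K (x t) (u t) @[t --> within D (nbhs t0)] --> grad_u K (x t0) (u t0) ->
  u t @[t --> within D (nbhs t0)] --> u t0.
Proof.
move=> xc gc; apply/cvgrPdist_le => e e0.
pose Phi (t : R) (w : 'cV[R]_m) := K (x t, w) - K (x t, u t0)
  - dotv (grad_u K (x t) (u t)) (w - u t0).
have cS := (compact_near_coveringP _).1 (@compact_sphere _ _ (u t0) e).
have Kc : continuous K by move=> q; exact: differentiable_continuous.
(* Compactness of the sphere makes one neighbourhood of [t0] serve for all its points. *)
have nS : \forall t \near within D (nbhs t0),
    [set w | `|w - u t0| = e] `<=` [set w | 0 < Phi t w].
  apply: cS => w /= we.
  have Phi0 : 0 < Phi t0 w.
    have ne : (x t0, u t0) != (x t0, w).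
      apply/eqP => -[] uw; move: we; rewrite -uw subrr normr0 => ee.
      by rewrite -ee ltxx in e0.
    have := grad_lt_increment ne.
    by rewrite subrr dotv0r add0r /Phi; lra.
  have PhiC : Phi z.2 z.1 @[z --> (nbhs w, within D (nbhs t0))] --> Phi t0 w.
    have x2 : x z.2 @[z --> (nbhs w, within D (nbhs t0))] --> x t0.
      exact: cvg_comp cvg_snd xc.
    apply: cvgB; first apply: cvgB.
    - apply: (@cvg_comp _ _ _ (fun z : 'cV[R]_m * R => (x z.2, z.1)) K _
        (nbhs (x t0, w))); last exact: Kc.
      exact: (cvg_pair x2 cvg_fst).
    - apply: (@cvg_comp _ _ _ (fun z : 'cV[R]_m * R => (x z.2, u t0)) K _
        (nbhs (x t0, u t0))); last exact: Kc.
      exact: (cvg_pair x2 (cvg_cst _)).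
    - apply: cvg_dotv; first exact: cvg_comp cvg_snd gc.
      apply: cvgB; [exact: cvg_fst|exact: cvg_cst].
  exact: (cvgr_gt _ PhiC _ Phi0).
near=> t.
have SPhi : [set w | `|w - u t0| = e] `<=` [set w | 0 < Phi t w] by near: t.
rewrite leNgt; apply/negP => er.
pose r := `|u t0 - u t|.
have r0 : 0 < r by exact: lt_trans er.
(* If [u t] lay outside the sphere, the segment from [u t0] to [u t] would cross it here. [Phi t] is
   convex, vanishes at [u t0] and is negative at its minimiser [u t], so it would be negative at the
   crossing point. *)
have /SPhi /= : `|((e / r) *: (u t - u t0) + u t0) - u t0| = e.
  by rewrite addrK normrZ distrC ger0_norm ?divr_ge0 1?ltW// divfK ?gt_eqF.
rewrite /Phi addrK.
have ne : (x t, u t) != (x t, u t0).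
  apply/eqP => -[] uu; move: r0; rewrite /r uu subrr normr0 ltxx//.
have := grad_lt_increment ne.
have /(strictly_convex_le K_convex (x t, u t0) (0, u t - u t0)) : 0 <= e / r <= 1.
  by apply/andP; split; [rewrite divr_ge0// ltW|rewrite ler_pdivrMr// mul1r ltW].
have pD (a b : 'cV[R]_m) (s : R) : s *: (0 : 'cV[R]_n, a) + (x t, b) =
    (x t, s *: a + b) by rewrite -[LHS]/(_, _) /= scaler0 add0r.
rewrite pD -{1}[(0, u t - u t0)]scale1r pD scale1r subrK.
rewrite dotvZr subrr dotv0r add0r -[u t - u t0]opprB dotvNr.
set F1 := K _; set F2 := K _; set F3 := K _; set d := dotv _ _.
have er0 : 0 < e / r by rewrite divr_gt0.
move=> H1 H2; nra.
Unshelve. all: by end_near. Qed.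

End Gradient.

(** * Integrals over the time interval *)

Section Integration.
Context {R : realType} (T : R).
Hypothesis T_gt0 : 0 < T.
Local Notation I := [set t : R | 0 <= t <= T].
Local Notation J := [set tau : R | 0 <= tau].
Local Notation mu := (@lebesgue_measure R).

Lemma time_itv : I = `[0, T]%classic.
Proof. by apply/seteqP; split => t /=; rewrite in_itv. Qed.

Lemma measurable_time : measurable (I : set R).
Proof. by rewrite time_itv; exact: measurable_itv. Qed.

Lemma within_continuous_time (f : R -> R) :
  (forall t, I t -> f s @[s --> within I (nbhs t)] --> f t) ->
  {within `[0, T], continuous f}.
Proof. by move=> fc; rewrite -time_itv; apply/subspace_continuousP. Qed.

Lemma integrable_time (f : R -> R) :
  (forall t, I t -> f s @[s --> within I (nbhs t)] --> f t) ->
  mu.-integrable I (EFin \o f).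
Proof.
move=> fc; rewrite time_itv; apply: continuous_compact_integrable.
  exact: segment_compact.
exact: within_continuous_time.
Qed.

(** Every point is joined within the interval to a distinct end point: 0 to [T], and any other point
    to 0. *)
Lemma time_dnbhs_proper t : I t -> ProperFilter (within I t^').
Proof.
move=> /= /andP[t0 tT].
have [->|tn] := eqVneq t 0.
  apply: (@segment_within_dnbhs_proper _ _ _ T); first by rewrite gt_eqF.
  by move=> s /andP[s0 s1] /=; apply/andP; split; nra.
apply: (@segment_within_dnbhs_proper _ _ _ 0); first by rewrite eq_sym.
by move=> s /andP[s0 s1] /=; apply/andP; split; nra.
Qed.

Lemma tau_dnbhs_proper tau : J tau -> ProperFilter (within J tau^').
Proof.
move=> /= tau0; apply: (@segment_within_dnbhs_proper _ _ _ (tau + 1)).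
  by rewrite -subr_eq0 addrAC subrr add0r oner_eq0.
by move=> s /andP[s0 s1] /=; nra.
Qed.

Lemma Rintegral_cst_itv (a b c : R) : a < b ->
  \int[mu]_(t in `[a, b]%classic) c = c * (b - a).
Proof.
move=> ab; rewrite Rintegral_cst//; congr (_ * _).
have mE : mu `[a, b]%classic = (b - a)%:E by rewrite lebesgue_measure_itv/= lte_fin ab.
exact: (congr1 fine mE).
Qed.

(** Where [f] is positive, continuity keeps it above half its value on a nondegenerate interval,
    whose contribution to the integral is positive. *)
Lemma Rintegral_continuous_eq0 (f : R -> R) :
  (forall t, I t -> f s @[s --> within I (nbhs t)] --> f t) ->
  (forall t, I t -> 0 <= f t) -> \int[mu]_(t in I) f t = 0 ->
  forall t, I t -> f t = 0.
Proof.
move=> fc f0 intf t0 It0; apply/eqP; rewrite eq_le f0// andbT leNgt.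
apply/negP => ft0; pose c := f t0 / 2.
have c0 : 0 < c by rewrite divr_gt0.
have : \forall s \near within I (nbhs t0), c < f s.
  by apply: (cvgr_gt _ (fc _ It0)); rewrite /c; lra.
move=> /nbhs_ballP[e /= e0 ec].
(* Truncation keeps the interval inside the domain; since [0 < T] it stays nondegenerate even when
   [t0] is an end point. The radius [e / 2] fits the closed interval into the open ball. *)
pose a : R := Num.max 0 (t0 - e / 2); pose b : R := Num.min T (t0 + e / 2).
have [/= /andP[t00 t0T]] := It0.
have ab : a < b.
  rewrite /a /b gt_max !lt_min T_gt0 /=; apply/and3P; split; lra.
have a_ge : 0 <= a /\ t0 - e / 2 <= a by rewrite /a !le_max !lexx orbT.
have b_le : b <= T /\ b <= t0 + e / 2 by rewrite /b !ge_min !lexx orbT.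
have abI : `[a, b]%classic `<=` I.
  by move=> s /=; rewrite in_itv/= => /andP[as_ sb]; apply/andP; split; lra.
have fcab s : `[a, b]%classic s -> c <= f s.
  move=> abs; apply/ltW/ec; last exact: abI.
  move: abs; rewrite /= in_itv/= /ball/= ltr_norml => /andP[as_ sb].
  by apply/andP; split; lra.
have intI := integrable_time fc.
have intab : mu.-integrable `[a, b]%classic (EFin \o f).
  by apply: integrableS intI => //; exact: measurable_time.
have : \int[mu]_(t in `[a, b]%classic) c <= \int[mu]_(t in `[a, b]%classic) f t.
  apply: le_Rintegral => //.
  apply: continuous_compact_integrable; first exact: segment_compact.
  by apply: continuous_subspaceT => x; exact: cvg_cst.
have : \int[mu]_(t in `[a, b]%classic) f t <= \int[mu]_(t in I) f t.
  apply: fine_le.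
  - exact: integrable_fin_num.
  - by apply: integrable_fin_num => //; exact: measurable_time.
  - apply: ge0_subset_integral => //; first exact: measurable_time.
      by case/integrableP : intI.
rewrite intf Rintegral_cst_itv// => H1 H2.
have := le_trans H2 H1.
move=> H.
have : 0 < c * (b - a) by rewrite mulr_gt0// subr_gt0.
by rewrite ltNge H.
Qed.

(** Fundamental theorem of calculus: the relative derivative is two-sided in the interior, and at
    the end points only continuity of [w] is called for. *)
Lemma Rintegral_deriv_in (w dw : R -> R) :
  (forall t, I t -> dw s @[s --> within I (nbhs t)] --> dw t) ->
  (forall t, I t -> has_deriv_in I w t (dw t)) ->
  \int[mu]_(t in I) dw t = w T - w 0.
Proof.
move=> dwc wd.
have wc : {within `[0, T], continuous w}.
  by apply: within_continuous_time => t It; exact: has_deriv_in_cvg (wd t It).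
have wder t : t \in `]0, T[ -> is_derive t 1 w (dw t).
  rewrite in_itv/= => /andP[t0 tT]; apply: has_deriv_in_is_derive (wd _ _).
    near=> s; apply/andP; split; apply/ltW; near: s.
      exact: lt_nbhsr.
    exact: lt_nbhsl.
  by rewrite /= !ltW.
rewrite /Rintegral time_itv (@continuous_FTC2 _ dw w 0 T) //.
- exact: within_continuous_time.
- split.
  + by move=> t tI; have [] := wder t tI.
  + by move/continuous_within_itvP : wc => /(_ T_gt0)[].
  + by move/continuous_within_itvP : wc => /(_ T_gt0)[].
- by move=> t /wder wt; rewrite derive1E; exact: derive_val.
Unshelve. all: by end_near. Qed.

Lemma nonincreasing_deriv_in (F dF : R -> R) :
  (forall tau, J tau -> has_deriv_in J F tau (dF tau)) ->
  (forall tau, J tau -> dF tau <= 0) -> forall tau, J tau -> F tau <= F 0.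
Proof.
move=> Fd dF0 tau tau0.
have wder t : t \in `]0, tau[ -> is_derive t 1 F (dF t).
  rewrite in_itv/= => /andP[t0 tT]; apply: has_deriv_in_is_derive (Fd _ _).
    by near=> s; apply/ltW; near: s; exact: lt_nbhsr.
  exact: ltW.
apply: (@ler0_derive1_le_cc _ F 0 tau).
- by move=> t tI; have [] := wder t tI.
- move=> t tI; rewrite derive1E; have [_ ->] := wder t tI; apply: dF0.
  by move: tI; rewrite in_itv/= => /andP[/ltW].
- apply: (@continuous_subspaceW _ _ _ J).
    by move=> s /=; rewrite in_itv/= => /andP[].
  apply/subspace_continuousP => s Js; exact: has_deriv_in_cvg (Fd s Js).
- by rewrite in_itv/= lexx ?andbT.
- by rewrite in_itv/= lexx ?andbT.
- by [].
Unshelve. all: by end_near. Qed.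

Lemma cvg_slice_t (V : normedModType R) (f : R -> R -> V) t tau :
  continuous_tt T f -> J tau -> I t ->
  f s tau @[s --> within I (nbhs t)] --> f t tau.
Proof.
move=> /subspace_continuousP fc Jtau It.
suff st : (s, tau) @[s --> within I (nbhs t)] --> within (I `*` J) (nbhs (t, tau)).
  exact: cvg_comp st (fc (t, tau) (conj It Jtau)).
move=> Q [[Q1 Q2] /= [nQ1 nQ2] sQ].
apply: filterS nQ1 => s Q1s Is.
by apply: (sQ (s, tau)) => //; split => //; exact: nbhs_singleton.
Qed.

Lemma cvg_within_fst (t tau : R) :
  q.1 @[q --> within (I `*` J) (nbhs (t, tau))] --> within I (nbhs t).
Proof.
move=> Q nQ; exists (fun s => I s -> Q s, setT) => /=.
  by split => //; exact: filterT.
by move=> [s h] [/= Qs _] [/= Is _]; exact: Qs.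
Qed.

(** By the mean value theorem the quotient of [g t] is a value of [dg t] between [tau] and [h];
    compactness of the time interval makes [dg] close to its value at [tau] uniformly in [t]. *)
Lemma deriv_in_Rintegral (g dg : R -> R -> R) tau :
  (forall t h, I t -> J h -> has_deriv_in J (g t) h (dg t h)) ->
  continuous_tt T g -> continuous_tt T dg -> J tau ->
  has_deriv_in J (fun h => \int[mu]_(t in I) g t h) tau (\int[mu]_(t in I) dg t tau).
Proof.
move=> gd gc dgc Jtau; apply/cvgrPdist_le => e e0.
(* Integrated over an interval of length [T], the bound [e'] yields at most [e]. *)
pose e' := e / (T + 1).
have e'0 : 0 < e' by rewrite divr_gt0// addr_gt0.
have tube : \forall h \near within J (nbhs tau),
    I `<=` [set t | `|dg t h - dg t tau| <= e'].
  have cI : compact I by rewrite time_itv; exact: segment_compact.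
  (* Membership in the interval is repeated inside the set because neighbourhoods of its points may
     leave it, where nothing is known of [dg]. *)
  have H : \forall h \near within J (nbhs tau),
      I `<=` [set t | I t -> `|dg t h - dg t tau| <= e'].
    apply: ((compact_near_coveringP _).1 cI) => t It.
  move/subspace_continuousP : dgc => /(_ (t, tau) (conj It Jtau)).
  move=> /cvgrPdist_le /(_ (e' / 2)).
  rewrite divr_gt0// => /(_ isT) [[Q1 Q2] /= [nQ1 nQ2] sQ].
  exists (Q1, (fun h => J h /\ Q2 h)) => /=.
    by split => //; apply: filterS nQ2.
  move=> [t' h] /= [Q1t [Jh Q2h]] It'.
    have H1 : `|dg t tau - dg t' h| <= e' / 2 by exact: (sQ (t', h)).
    have H2 : `|dg t tau - dg t' tau| <= e' / 2.
      by apply: (sQ (t', tau)) => //; split => //; exact: nbhs_singleton.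
    by rewrite (splitr e') (le_trans (ler_distD (dg t tau) _ _))// lerD// distrC.
  by near=> h => t It; apply: (near H h).
move: tube => /nbhs_ballP[d /= d0 dP].
have dqE h t : J h -> ball tau d h -> h != tau -> I t ->
    `|dg t tau - diff_quot (g t) tau h| <= e'.
  move=> Jh bh hn It.
  (* Stated for ordered end points, as [h] may lie on either side of [tau]. *)
  have mvt a b : J a -> a < b ->
      exists2 c, a < c < b & g t b - g t a = dg t c * (b - a).
    move=> Ja ab.
    have wder s : s \in `]a, b[ -> is_derive s 1 (g t) (dg t s).
      rewrite in_itv/= => /andP[as_ sb].
      have s0 : 0 < s by exact: le_lt_trans as_.
      apply: has_deriv_in_is_derive (gd _ _ It _); last exact: ltW.
      by near=> s'; apply/ltW; near: s'; exact: lt_nbhsr.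
    have [|c] := MVT ab wder.
      apply: (@continuous_subspaceW _ _ _ J).
        by move=> s /=; rewrite in_itv/= => /andP[/(le_trans Ja)].
      apply/subspace_continuousP => s Js; exact: has_deriv_in_cvg (gd t s It Js).
    by rewrite in_itv/= => cab ?; exists c.
  rewrite /diff_quot distrC.
  have [c cb ->] : exists2 c, J c /\ ball tau d c &
      (h - tau)^-1 *: (g t h - g t tau) = dg t c.
    move: bh; rewrite /ball/= ltr_norml => /andP[b1 b2].
    case: (ltgtP h tau) hn => // [hlt|hgt] _.
      have [c /andP[c1 c2] E] := mvt _ _ Jh hlt; exists c.
        split; first by rewrite /= (le_trans Jh)// ltW.
        by rewrite /ball/= ltr_norml; apply/andP; split; lra.
      have -> : g t h - g t tau = dg t c * (h - tau).
        by rewrite -[LHS]opprB E -mulrN opprB.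
      rewrite [LHS]mulrC mulfK// subr_eq0.
      by rewrite lt_eqF.
    have [c /andP[c1 c2] E] := mvt _ _ Jtau hgt; exists c.
      split; first by rewrite /= (le_trans Jtau)// ltW.
      by rewrite /ball/= ltr_norml; apply/andP; split; lra.
    rewrite E [LHS]mulrC mulfK// subr_eq0.
    by rewrite gt_eqF.
  by case: cb => Jc bc; exact: (dP c bc Jc).
have ig h : J h -> mu.-integrable I (EFin \o (g ^~ h)).
  by move=> Jh; apply: integrable_time => t It; exact: cvg_slice_t.
have idg h : J h -> mu.-integrable I (EFin \o (dg ^~ h)).
  by move=> Jh; apply: integrable_time => t It; exact: cvg_slice_t.
near=> h.
have Jh : J h by near: h; exact: withinT.
have hn : h != tau by near: h; apply: cvg_within; exact: withinT.
have bh : ball tau d h.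
  by near: h; apply: cvg_within; apply: nbhs_dnbhs; exact: nbhsx_ballx.
have cdq t : I t -> diff_quot (g s) tau h @[s --> within I (nbhs t)] -->
    diff_quot (g t) tau h.
  by move=> It; exact: (cvgM (cvg_cst _)
    (cvgB (cvg_slice_t gc Jh It) (cvg_slice_t gc Jtau It))).
have -> : diff_quot (fun h => \int[mu]_(t in I) g t h) tau h =
    \int[mu]_(t in I) diff_quot (g t) tau h.
  rewrite /diff_quot -RintegralB//; [|exact: measurable_time|exact: ig|exact: ig].
  rewrite -[LHS]/(_ * _) -RintegralZl//; first exact: measurable_time.
  apply: integrable_time => t It; apply: cvgB; exact: cvg_slice_t.
rewrite -RintegralB//; [|exact: measurable_time|exact: idg|exact: integrable_time].
have cd t : I t -> dg s tau - diff_quot (g s) tau h @[s --> within I (nbhs t)] -->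
    dg t tau - diff_quot (g t) tau h.
  by move=> It; apply: cvgB; [exact: cvg_slice_t|exact: cdq].
apply: (le_trans (le_normr_Rintegral _ _)).
- exact: measurable_time.
- exact: integrable_time.
apply: (@le_trans _ _ (\int[mu]_(t in I) e')).
  apply: le_Rintegral; first exact: measurable_time.
  - by apply: integrable_time => t It; apply: cvg_norm; exact: cd.
  - by apply: integrable_time => t It; exact: cvg_cst.
  - by move=> t It; exact: dqE.
rewrite time_itv Rintegral_cst_itv// subr0 /e'.
by rewrite mulrAC ler_pdivrMr ?addr_gt0// ler_wpM2l// ?ltW// ltrDl.
Unshelve. all: by end_near. Qed.

End Integration.

(** * The dynamics *)

Section PositiveDefinite.
Context {R : realType} {k : nat} {M : 'M[R]_k}.
Hypothesis M_pos : posdefmx M.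

(** The form vanishes on the kernel, so the kernel is trivial. *)
Lemma posdefmx_unit : M \in unitmx.
Proof.
case: M_pos => MT Mpos; rewrite -row_free_unit -kermx_eq0.
apply/negP => /negP /rowV0Pn[v /sub_kermxP vM v0].
have : v^T != 0 by rewrite -(inj_eq trmx_inj) trmxK trmx0.
by move=> /Mpos; rewrite /qform trmxK vM mul0mx mxE ltxx.
Qed.

Lemma trmx_invmx_posdef : (invmx M)^T = invmx M.
Proof. by case: M_pos => MT _; rewrite trmx_inv MT. Qed.

(** By symmetry, the form of the inverse at [y] is the form of [M] at [invmx M *m y]. *)
Lemma qform_invmx_gt0 (y : 'cV[R]_k) : y != 0 -> 0 < qform (invmx M) y.
Proof.
case: M_pos => MT Mpos y0.
have : invmx M *m y != 0.
  apply: contra y0 => /eqP My; rewrite -[y]mul1mx -(mulmxV posdefmx_unit).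
  by rewrite -mulmxA My mulmx0.
move=> /Mpos; rewrite /qform trmx_mul trmx_invmx_posdef.
by rewrite -!mulmxA (mulmxA M) (mulmxV posdefmx_unit) mul1mx.
Qed.

Lemma qform_invmx_ge0 (y : 'cV[R]_k) : 0 <= qform (invmx M) y.
Proof.
have [->|y0] := eqVneq y 0; first by rewrite /qform mulmx0 mxE.
exact/ltW/qform_invmx_gt0.
Qed.

Lemma qform_invmx_eq0 (y : 'cV[R]_k) : qform (invmx M) y <= 0 -> y = 0.
Proof.
move=> q0; apply/eqP; apply/negPn/negP => /qform_invmx_gt0.
by rewrite ltNge q0.
Qed.

End PositiveDefinite.

Lemma has_deriv_in_qform (R : realType) (D : set R) k (M : 'M[R]_k)
    (y : R -> 'cV[R]_k) a dy :
  M^T = M -> has_deriv_in D y a dy ->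
  has_deriv_in D (fun b => qform M (y b) : R) a (2 * dotv (M *m y a) dy).
Proof.
move=> MT yd.
have := has_deriv_in_dotv yd (has_deriv_in_mulmxr M yd).
rewrite (dotvC dy) (dotv_mulmx M) MT -mulr2n mulr_natl.
congr (has_deriv_in _ _ _ _); apply/funext => b.
by rewrite /dotv /qform mulmxA.
Qed.

(** The hypothesis says, after transposition, that [q^T] annihilates every block of the
    controllability matrix; that matrix has full row rank. *)
Lemma controllable_eq0 (R : realType) n m (A : 'M[R]_n) (B : 'M[R]_(n, m))
    (q : 'cV[R]_n) :
  controllable A B -> (forall j, B^T *m (A^T ^+ j *m q) = 0) -> q = 0.
Proof.
move=> AB Bq; apply: trmx_inj; apply/eqP; rewrite trmx0.
rewrite -(@mulmx_free_eq0 _ _ _ _ _ (\mxrow_(j < n) (A ^+ j *m B))); last first.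
  by rewrite /row_free AB.
have AT j : (A ^+ j)^T = A^T ^+ j.
  elim: j => [|j IHj]; first by rewrite !expr0 trmx1.
  by rewrite exprS exprSr -[A * _]/(A *m _) trmx_mul IHj.
have qAB (j : 'I_n) : q^T *m (A ^+ j *m B) = 0.
  by apply: trmx_inj; rewrite !trmx_mul trmxK AT trmx0 -mulmxA.
by rewrite mul_mxrow (eq_mxrow qAB) mxrow0.
Qed.

Section Dynamics.
Context {R : realType} {n m : nat} {T : R} {A : 'M[R]_n} {B : 'M[R]_(n, m)}
  {x0 : 'cV[R]_n} {K : 'cV[R]_n * 'cV[R]_m -> R}
  {X : 'M[R]_n} {U : 'M[R]_m} {P : 'M[R]_n}
  {xs : R -> 'cV[R]_n} {us : R -> 'cV[R]_m} {ps : R -> 'cV[R]_n}.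
Hypothesis T_gt0 : 0 < T.
Hypothesis K_convex : strictly_convex K.
Hypothesis K_diff : forall q, differentiable K q.
Hypothesis X_pos : posdefmx X.
Hypothesis U_pos : posdefmx U.
Hypothesis P_pos : posdefmx P.
Hypothesis xup_opt : pontryagin T A B x0 K xs us ps.

Local Notation I := [set t : R | 0 <= t <= T].
Local Notation J := [set tau : R | 0 <= tau].
Local Notation mu := (@lebesgue_measure R).
Local Notation st := (star X U P xs us ps).
Local Notation sol := (solution T A B x0 K X U P xs us ps).
Local Notation H := (Htilde T X U P xs us ps).
Local Notation xi := (dHdz X U P xs us ps).
Local Notation eta := (dHdv X U P xs us ps).
Local Notation rho := (dHdr X U P xs us ps).

Lemma continuous_ttP (V : normedModType R) (f : R -> R -> V) :
  continuous_tt T f <-> forall t tau, I t -> J tau ->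
    f q.1 q.2 @[q --> within (I `*` J) (nbhs (t, tau))] --> f t tau.
Proof.
split=> [/subspace_continuousP fc t tau It Jtau|fc].
  exact: (fc (t, tau)).
by apply/subspace_continuousP => -[t tau] [It Jtau]; exact: fc.
Qed.

Lemma eq_continuous_tt (V : normedModType R) (f g : R -> R -> V) :
  (forall t tau, I t -> J tau -> f t tau = g t tau) ->
  continuous_tt T f -> continuous_tt T g.
Proof.
move=> fg /continuous_ttP fc; apply/continuous_ttP => t tau It Jtau.
rewrite -fg//; apply: cvg_trans (fc t tau It Jtau); apply: near_eq_cvg.
by rewrite near_withinE; apply: nearW => -[s h] [Is Jh]; exact: fg.
Qed.

Lemma cvg_tt_fst (V : normedModType R) (f : R -> V) (t tau : R) :
  f s @[s --> within I (nbhs t)] --> f t ->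
  f q.1 @[q --> within (I `*` J) (nbhs (t, tau))] --> f t.
Proof. by move=> fc; exact: cvg_comp (@cvg_within_fst _ T t tau) fc. Qed.

Lemma continuous_tt_fst (V : normedModType R) (f : R -> V) :
  (forall t, I t -> f s @[s --> within I (nbhs t)] --> f t) ->
  continuous_tt T (fun t _ => f t).
Proof.
by move=> fc; apply/continuous_ttP => t tau It _; apply: cvg_tt_fst; exact: fc.
Qed.

Lemma xs_deriv t : I t -> has_deriv_in I xs t (A *m xs t + B *m us t).
Proof. by case: xup_opt => xsd _ _ _ _ It; have [/derivable_inP + <-] := xsd t It. Qed.

Lemma ps_deriv t : I t ->
  has_deriv_in I ps t (- (A^T *m ps t) - grad_x K (xs t) (us t)).
Proof. by case: xup_opt => _ _ _ psd _ It; have [/derivable_inP + <-] := psd t It. Qed.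

Lemma xs_cvg t : I t -> xs s @[s --> within I (nbhs t)] --> xs t.
Proof. by move=> It; exact: has_deriv_in_cvg (xs_deriv It). Qed.

Lemma ps_cvg t : I t -> ps s @[s --> within I (nbhs t)] --> ps t.
Proof. by move=> It; exact: has_deriv_in_cvg (ps_deriv It). Qed.

(** The stationarity condition equates the control gradient with [- (B^T *m ps t)], which is
    continuous, and [cvg_of_grad_u] inverts the gradient. *)
Lemma us_cvg t : I t -> us s @[s --> within I (nbhs t)] --> us t.
Proof.
move=> It; apply: (cvg_of_grad_u K_convex K_diff (xs_cvg It)).
case: xup_opt => _ _ gu _ _.
have guE s : I s -> - (B^T *m ps s) = grad_u K (xs s) (us s).
  by move=> /gu /eqP; rewrite eq_sym addrC addr_eq0 => /eqP.
rewrite -guE//.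
have : - (B^T *m ps s) @[s --> within I (nbhs t)] --> - (B^T *m ps t).
  by apply: cvgN; apply: cvg_mulmxr; exact: ps_cvg.
apply: cvg_trans; apply: near_eq_cvg.
by rewrite near_withinE; apply: nearW => s Is; rewrite guE.
Qed.

Lemma xs_deriv_cvg t : I t ->
  A *m xs s + B *m us s @[s --> within I (nbhs t)] --> A *m xs t + B *m us t.
Proof.
by move=> It; apply: cvgD; apply: cvg_mulmxr; [exact: xs_cvg|exact: us_cvg].
Qed.

Lemma ps_deriv_cvg t : I t ->
  - (A^T *m ps s) - grad_x K (xs s) (us s) @[s --> within I (nbhs t)] -->
  - (A^T *m ps t) - grad_x K (xs t) (us t).
Proof.
move=> It; apply: cvgB.
  by apply: cvgN; apply: cvg_mulmxr; exact: ps_cvg.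
by apply: cvg_grad_x => //; [exact: xs_cvg|exact: us_cvg].
Qed.

Lemma dHdzE s t : xi s t = invmx X *m sz s t - xs t.
Proof. by rewrite /dHdz /= mulmxBr mulKmx// posdefmx_unit. Qed.

Lemma dHdvE s t : eta s t = invmx U *m sv s t - us t.
Proof. by rewrite /dHdv /= mulmxBr mulKmx// posdefmx_unit. Qed.

Lemma dHdrE s t : rho s t = invmx P *m sr s t - ps t.
Proof. by rewrite /dHdr /= mulmxBr mulKmx// posdefmx_unit. Qed.

(** For the trajectory constant in tau both sides of the equations vanish. What takes work is the
    joint continuity of the state and of its t-derivatives, which rests on [us_cvg]. *)
Lemma star_solution : sol (fun=> st).
Proof.
have XV : X \in unitmx by exact: posdefmx_unit.
have UV : U \in unitmx by exact: posdefmx_unit.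
have PV : P \in unitmx by exact: posdefmx_unit.
have cstJ (V : normedModType R) (c : V) tau : J tau -> deriv_in J (fun=> c) tau = 0.
  move=> Jt; apply: has_deriv_in_unique (has_deriv_in_cst _ _ _).
  exact: tau_dnbhs_proper.
have Xd t (It : I t) := has_deriv_in_mulmxr X (xs_deriv It).
have Pd t (It : I t) := has_deriv_in_mulmxr P (ps_deriv It).
split.
- split.
  + move=> t tau It Jtau; split.
    * exact: has_deriv_in_derivable (has_deriv_in_cst _ _ _).
    * exact: has_deriv_in_derivable (has_deriv_in_cst _ _ _).
    * exact: has_deriv_in_derivable (has_deriv_in_cst _ _ _).
    * exact: has_deriv_in_derivable (Xd t It).
    * exact: has_deriv_in_derivable (Pd t It).
  + split; apply: continuous_tt_fst => t It; apply: cvg_mulmxr.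
    * exact: xs_cvg.
    * exact: us_cvg.
    * exact: ps_cvg.
  + have c0 k : continuous_tt T (fun _ _ => 0 : 'cV[R]_k).
      by apply: continuous_tt_fst => t It; exact: cvg_cst.
    by split; apply: eq_continuous_tt (c0 _) => t tau It Jtau; rewrite [RHS]cstJ.
  + split.
    * apply: (@eq_continuous_tt _ (fun t _ => X *m (A *m xs t + B *m us t))).
        move=> t tau It Jtau; apply/esym/has_deriv_in_unique; last exact: Xd.
        exact: time_dnbhs_proper.
      apply: continuous_tt_fst => t It; apply: cvg_mulmxr; exact: xs_deriv_cvg.
    * apply: (@eq_continuous_tt _
        (fun t _ => P *m (- (A^T *m ps t) - grad_x K (xs t) (us t)))).
        move=> t tau It Jtau; apply/esym/has_deriv_in_unique; last exact: Pd.
        exact: time_dnbhs_proper.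
      apply: continuous_tt_fst => t It; apply: cvg_mulmxr; exact: ps_deriv_cvg.
- have xi0 : xi st = fun=> 0 by apply/funext => t; rewrite dHdzE /= mulKmx// subrr.
  have eta0 : eta st = fun=> 0 by apply/funext => t; rewrite dHdvE /= mulKmx// subrr.
  have rho0 : rho st = fun=> 0 by apply/funext => t; rewrite dHdrE /= mulKmx// subrr.
  have cstI (V : normedModType R) (c : V) t : I t -> deriv_in I (fun=> c) t = 0.
    move=> It; apply: has_deriv_in_unique (has_deriv_in_cst _ _ _).
    exact: time_dnbhs_proper.
  move=> t tau It Jtau /=; rewrite !mulKmx// !subrr.
  rewrite /dtau_z /dtau_v /dtau_r !cstJ// xi0 eta0 rho0 !cstI//.
  by rewrite !mulmx0 !subr0 !oppr0 !addr0.
- move=> tau Jtau; rewrite /= !mulKmx//.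
  by case: xup_opt => _ -> _ _ ->.
Qed.

(** * Energy balance along a solution *)

Section Trajectory.
Variable sigma : R -> state R n m.
Hypothesis sigma_sol : sol sigma.

(** The symmetrised Bregman divergence of [K] between the current and the optimal pair. *)
Definition dissipation (t tau : R) : R :=
  let x := invmx X *m sz (sigma tau) t in
  let u := invmx U *m sv (sigma tau) t in
  dotv (xi (sigma tau) t) (grad_x K x u - grad_x K (xs t) (us t))
  + dotv (eta (sigma tau) t) (grad_u K x u - grad_u K (xs t) (us t)).

Lemma dissipation_ge0 t tau : 0 <= dissipation t tau.
Proof.
rewrite /dissipation dHdzE dHdvE; set x := invmx X *m _; set u := invmx U *m _.
have [[-> ->]|ne] := eqVneq (xs t, us t) (x, u); first by rewrite !subrr !dotv0r addr0.
exact/ltW/(grad_monotone K_convex K_diff).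
Qed.

Lemma dissipation_eq0 t tau : dissipation t tau = 0 ->
  sz (sigma tau) t = sz st t /\ sv (sigma tau) t = sv st t.
Proof.
rewrite /dissipation dHdzE dHdvE; set x := invmx X *m _; set u := invmx U *m _.
have [[xE uE] _|ne d0] := eqVneq (xs t, us t) (x, u).
  by rewrite /= xE uE /x /u !mulKVmx// posdefmx_unit.
by have := grad_monotone K_convex K_diff ne; rewrite d0 ltxx.
Qed.

Lemma sz_ctt : continuous_tt T (fun t tau => sz (sigma tau) t).
Proof. by case: sigma_sol => -[_ [? ? ?] _ _] _ _. Qed.
Lemma sv_ctt : continuous_tt T (fun t tau => sv (sigma tau) t).
Proof. by case: sigma_sol => -[_ [? ? ?] _ _] _ _. Qed.
Lemma sr_ctt : continuous_tt T (fun t tau => sr (sigma tau) t).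
Proof. by case: sigma_sol => -[_ [? ? ?] _ _] _ _. Qed.

Lemma dissipation_cvg t tau : I t -> J tau ->
  dissipation s tau @[s --> within I (nbhs t)] --> dissipation t tau.
Proof.
move=> It Jtau.
have zc := cvg_slice_t sz_ctt Jtau It.
have vc := cvg_slice_t sv_ctt Jtau It.
have xc := xs_cvg It; have uc := us_cvg It.
apply: cvgD; apply: cvg_dotv.
- by apply: cvg_mulmxr; apply: cvgB => //; exact: cvg_mulmxr.
- by apply: cvgB; apply: cvg_grad_x => //; apply: cvg_mulmxr.
- by apply: cvg_mulmxr; apply: cvgB => //; exact: cvg_mulmxr.
- by apply: cvgB; apply: cvg_grad_u => //; apply: cvg_mulmxr.
Qed.

Lemma dHdz_deriv t tau : I t -> J tau ->
  has_deriv_in I (xi (sigma tau)) t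
    (invmx X *m dt_z T sigma t tau - (A *m xs t + B *m us t)).
Proof.
move=> It Jtau; have [[/(_ t tau It Jtau)[_ _ _ zd _] _ _ _] _ _] := sigma_sol.
have := has_deriv_inB (has_deriv_in_mulmxr (invmx X) (derivable_inP zd)) (xs_deriv It).
by congr (has_deriv_in _ _ _ _); apply/funext => s; rewrite dHdzE.
Qed.

Lemma dHdr_deriv t tau : I t -> J tau ->
  has_deriv_in I (rho (sigma tau)) t (invmx P *m dt_r T sigma t tau
    - (- (A^T *m ps t) - grad_x K (xs t) (us t))).
Proof.
move=> It Jtau; have [[/(_ t tau It Jtau)[_ _ _ _ rd] _ _ _] _ _] := sigma_sol.
have := has_deriv_inB (has_deriv_in_mulmxr (invmx P) (derivable_inP rd)) (ps_deriv It).
by congr (has_deriv_in _ _ _ _); apply/funext => s; rewrite dHdrE.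
Qed.

Lemma dHdz_derivE t tau : I t -> J tau -> deriv_in I (xi (sigma tau)) t =
  invmx X *m dt_z T sigma t tau - (A *m xs t + B *m us t).
Proof.
move=> It Jt; apply: has_deriv_in_unique (dHdz_deriv It Jt).
exact: time_dnbhs_proper.
Qed.

Lemma dHdr_derivE t tau : I t -> J tau -> deriv_in I (rho (sigma tau)) t =
  invmx P *m dt_r T sigma t tau - (- (A^T *m ps t) - grad_x K (xs t) (us t)).
Proof.
move=> It Jt; apply: has_deriv_in_unique (dHdr_deriv It Jt).
exact: time_dnbhs_proper.
Qed.

Lemma dHdz0 tau : J tau -> xi (sigma tau) 0 = 0.
Proof.
move=> Jt; have [_ _ /(_ tau Jt)[b0 _]] := sigma_sol.
by case: xup_opt => _ xs0 _ _ _; rewrite dHdzE b0 xs0 subrr.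
Qed.

Lemma dHdrT tau : J tau -> rho (sigma tau) T = 0.
Proof.
move=> Jt; have [_ _ /(_ tau Jt)[_ bT]] := sigma_sol.
by case: xup_opt => _ _ _ _ psT; rewrite dHdrE bT psT subrr.
Qed.

(** The tau-derivative of the integrand of [Htilde], with the factor 1/2 included. *)
Definition power (t tau : R) : R :=
  dotv (xi (sigma tau) t) (dtau_z sigma t tau)
  + dotv (eta (sigma tau) t) (dtau_v sigma t tau)
  + dotv (rho (sigma tau) t) (dtau_r sigma t tau).

(** Moved across the inner product, the terms in [A^T] and [B^T] cancel those in [A] and [B]. The
    two t-derivatives combine into that of the product of [xi] and [rho]. *)
Lemma powerE t tau : I t -> J tau ->
  power t tau = - (dotv (deriv_in I (xi (sigma tau)) t) (rho (sigma tau) t)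
    + dotv (xi (sigma tau) t) (deriv_in I (rho (sigma tau)) t))
    - dissipation t tau.
Proof.
move=> It Jt; have [_ /(_ t tau It Jt)[zE vE rE] _] := sigma_sol.
rewrite /power zE vE rE /dissipation.
rewrite !(dotvDr, dotvNr).
rewrite (dotv_mulmx A^T) (dotv_mulmx B^T) !trmxK.
rewrite (dotvC (rho _ _) (deriv_in _ _ _)) (dotvC (rho _ _) (A *m _)).
rewrite (dotvC (rho _ _) (B *m _)).
by lra.
Qed.

Lemma power_ctt : continuous_tt T power.
Proof.
have [[_ _ [zc vc rc] _] _ _] := sigma_sol.
apply/continuous_ttP => t tau It Jt.
apply: cvgD; first apply: cvgD; apply: cvg_dotv.
- apply: cvg_mulmxr; apply: cvgB; first exact: (continuous_ttP _).1 sz_ctt t tau It Jt.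
  by apply: cvg_mulmxr; apply: cvg_tt_fst; exact: xs_cvg.
- exact: (continuous_ttP _).1 zc t tau It Jt.
- apply: cvg_mulmxr; apply: cvgB; first exact: (continuous_ttP _).1 sv_ctt t tau It Jt.
  by apply: cvg_mulmxr; apply: cvg_tt_fst; exact: us_cvg.
- exact: (continuous_ttP _).1 vc t tau It Jt.
- apply: cvg_mulmxr; apply: cvgB; first exact: (continuous_ttP _).1 sr_ctt t tau It Jt.
  by apply: cvg_mulmxr; apply: cvg_tt_fst; exact: ps_cvg.
- exact: (continuous_ttP _).1 rc t tau It Jt.
Qed.

(** The total t-derivative integrates to boundary values, which vanish because [xi] is 0 at 0 and
    [rho] is 0 at [T]. *)
Lemma Rintegral_power tau : J tau ->
  \int[mu]_(t in I) power t tau = - \int[mu]_(t in I) dissipation t tau.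
Proof.
move=> Jt.
pose w t := dotv (xi (sigma tau) t) (rho (sigma tau) t).
pose dw t := dotv (deriv_in I (xi (sigma tau)) t) (rho (sigma tau) t)
    + dotv (xi (sigma tau) t) (deriv_in I (rho (sigma tau)) t).
have wd t : I t -> has_deriv_in I w t (dw t).
  move=> It; apply: has_deriv_in_dotv.
    by rewrite dHdz_derivE//; exact: dHdz_deriv.
  by rewrite dHdr_derivE//; exact: dHdr_deriv.
(* This identity supplies the continuity of [dw] that the fundamental theorem of calculus
   demands. *)
have dwE t : I t -> - (power t tau + dissipation t tau) = dw t.
  by move=> It; rewrite powerE// /dw; ring.
have pdc t : I t -> - (power s tau + dissipation s tau) @[s --> within I (nbhs t)] -->
    - (power t tau + dissipation t tau).
  move=> It; apply: cvgN; apply: cvgD; last exact: dissipation_cvg.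
  by apply: cvg_slice_t => //; exact: power_ctt.
have wd' t : I t -> has_deriv_in I w t (- (power t tau + dissipation t tau)).
  by move=> It; rewrite dwE//; exact: wd.
have := Rintegral_deriv_in T_gt0 pdc wd'.
rewrite /w dHdz0// dHdrT// dotv0r (dotvC 0) dotv0r subr0.
have ip : mu.-integrable I (EFin \o (power ^~ tau)).
  by apply: integrable_time => t It; apply: cvg_slice_t => //; exact: power_ctt.
have id : mu.-integrable I (EFin \o (dissipation ^~ tau)).
  by apply: integrable_time => t It; exact: dissipation_cvg.
have mI := measurable_time T.
have -> : \int[mu]_(t in I) - (power t tau + dissipation t tau) =
    - (\int[mu]_(t in I) power t tau + \int[mu]_(t in I) dissipation t tau).
  rewrite -RintegralD// -mulN1r -RintegralZl//.
    by apply: eq_Rintegral => t _; rewrite mulN1r.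
  apply: integrable_time => t It; apply: cvgD; last exact: dissipation_cvg.
  by apply: cvg_slice_t => //; exact: power_ctt.
by move/eqP; rewrite oppr_eq0 addr_eq0 => /eqP.
Qed.

Definition energy (t tau : R) : R :=
  qform (invmx X) (sz (sigma tau) t - sz st t)
  + qform (invmx U) (sv (sigma tau) t - sv st t)
  + qform (invmx P) (sr (sigma tau) t - sr st t).

Lemma energy_ctt : continuous_tt T energy.
Proof.
apply/continuous_ttP => t tau It Jt.
have qc k (M : 'M[R]_k) (f : R * R -> 'cV[R]_k) (a : 'cV[R]_k) :
    f q @[q --> within (I `*` J) (nbhs (t, tau))] --> a ->
    qform M (f q) @[q --> within (I `*` J) (nbhs (t, tau))] --> qform M a.
  move=> fa; rewrite /qform.
  apply: ((cvg_mxP _ _).1 (cvg_mulmx (cvg_mulmx (cvg_trmx fa) (cvg_cst M)) fa)).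
apply: cvgD; first apply: cvgD; apply: qc; apply: cvgB.
- exact: (continuous_ttP _).1 sz_ctt t tau It Jt.
- by apply: cvg_mulmxr; apply: cvg_tt_fst; exact: xs_cvg.
- exact: (continuous_ttP _).1 sv_ctt t tau It Jt.
- by apply: cvg_mulmxr; apply: cvg_tt_fst; exact: us_cvg.
- exact: (continuous_ttP _).1 sr_ctt t tau It Jt.
- by apply: cvg_mulmxr; apply: cvg_tt_fst; exact: ps_cvg.
Qed.

Lemma energy_deriv t tau : I t -> J tau ->
  has_deriv_in J (energy t) tau (2 * power t tau).
Proof.
move=> It Jt; have [[/(_ t tau It Jt)[zd vd rd _ _] _ _ _] _ _] := sigma_sol.
have XT := trmx_invmx_posdef X_pos.
have UT := trmx_invmx_posdef U_pos.
have PT := trmx_invmx_posdef P_pos.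
have zd' := has_deriv_inB (derivable_inP zd) (has_deriv_in_cst J (sz st t) tau).
have vd' := has_deriv_inB (derivable_inP vd) (has_deriv_in_cst J (sv st t) tau).
have rd' := has_deriv_inB (derivable_inP rd) (has_deriv_in_cst J (sr st t) tau).
have := has_deriv_inD (has_deriv_inD (has_deriv_in_qform XT zd')
  (has_deriv_in_qform UT vd')) (has_deriv_in_qform PT rd').
by rewrite !subr0 -!mulrDr.
Qed.

(** Differentiation under the integral, then the power balance; the 2 from the quadratic forms
    cancels the 1/2 in [Htilde]. *)
Lemma Htilde_deriv tau : J tau ->
  has_deriv_in J (fun h => H (sigma h) : R) tau
    (- \int[mu]_(t in I) dissipation t tau).
Proof.
move=> Jt.
have c2 : continuous_tt T (fun t h => 2 * power t h).
  apply/continuous_ttP => t h It Jh; apply: cvgM; first exact: cvg_cst.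
  exact: (continuous_ttP _).1 power_ctt t h It Jh.
have := deriv_in_Rintegral T_gt0 energy_deriv energy_ctt c2 Jt.
rewrite RintegralZl; [|exact: measurable_time|]; last first.
  by apply: integrable_time => t It; apply: cvg_slice_t => //; exact: power_ctt.
rewrite Rintegral_power// => Ed.
rewrite /has_deriv_in.
have -> : diff_quot (fun h => H (sigma h) : R) tau =
    fun h => 2^-1 * diff_quot (fun h => \int[mu]_(t in I) energy t h) tau h.
  apply/funext => h; rewrite /diff_quot /Htilde -/(energy _ _) -mulrBr.
  exact: mulrCA.
rewrite -[X in _ --> X](mulKf (_ : 2 != 0 :> R))//.
by apply: cvgM; [exact: cvg_cst|exact: Ed].
Qed.

Lemma Htilde_le tau : J tau -> H (sigma tau) <= H (sigma 0).
Proof.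
apply: (nonincreasing_deriv_in Htilde_deriv) => h Jh.
by rewrite oppr_le0; apply: Rintegral_ge0 => t _; exact: dissipation_ge0.
Qed.

(** The integrand is continuous and nonnegative, so it vanishes pointwise, and each of its three
    definite forms with it. *)
Lemma Htilde_eq0 tau : J tau -> H (sigma tau) <= 0 -> eq_state T (sigma tau) st.
Proof.
move=> Jt H0.
have e0 t : I t -> 0 <= energy t tau.
  by move=> _; rewrite !addr_ge0//; exact: qform_invmx_ge0.
have intE : \int[mu]_(t in I) energy t tau = 0.
  apply/eqP; rewrite eq_le Rintegral_ge0// andbT.
  by move: H0; rewrite /Htilde pmulr_rle0// invr_gt0.
have ec t : I t -> energy s tau @[s --> within I (nbhs t)] --> energy t tau.
  by move=> It; apply: cvg_slice_t => //; exact: energy_ctt.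
move=> t It; have := Rintegral_continuous_eq0 T_gt0 ec e0 intE It.
rewrite /energy.
have := qform_invmx_ge0 X_pos (sz (sigma tau) t - sz st t).
have := qform_invmx_ge0 U_pos (sv (sigma tau) t - sv st t).
have := qform_invmx_ge0 P_pos (sr (sigma tau) t - sr st t).
move=> r0 v0 z0 E; split; apply/eqP; rewrite -subr_eq0; apply/eqP.
- by apply: (qform_invmx_eq0 X_pos); lra.
- by apply: (qform_invmx_eq0 U_pos); lra.
- by apply: (qform_invmx_eq0 P_pos); lra.
Qed.

Lemma stationary_zv tau : J tau ->
  deriv_in J (fun h => H (sigma h) : R^o) tau = 0 ->
  forall t, I t -> sz (sigma tau) t = sz st t /\ sv (sigma tau) t = sv st t.
Proof.
move=> Jt; have Hd := Htilde_deriv Jt.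
have -> := has_deriv_in_unique (tau_dnbhs_proper Jt) Hd.
move=> /eqP; rewrite oppr_eq0 => /eqP int0 t It; apply: dissipation_eq0.
apply: (Rintegral_continuous_eq0 T_gt0 _ _ int0) => // s Is.
  exact: dissipation_cvg.
exact: dissipation_ge0.
Qed.

(** * Recovering the costate from controllability *)

Hypothesis AB_ctrl : controllable A B.

(** With [z] and [v] frozen at their optimal values for all tau, the first two equations at tau = 0
    say that [rho] solves the adjoint equation with zero output [B^T *m rho]; such a [rho] is
    unobservable, hence 0. *)
Lemma stationary_r :
  (forall t tau, I t -> J tau ->
    sz (sigma tau) t = sz st t /\ sv (sigma tau) t = sv st t) ->
  forall t, I t -> sr (sigma 0) t = sr st t.
Proof.
move=> zv.
have J0 : J 0 by rewrite /=.
have [_ pdeE _] := sigma_sol.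
(* Constancy is known for nonnegative tau only, which suffices for the one-sided derivative at 0. *)
have cst0 k (f : R -> 'cV[R]_k) (c : 'cV[R]_k) : (forall h, J h -> f h = c) ->
    deriv_in J f 0 = 0.
  move=> fc; apply: (has_deriv_in_unique (tau_dnbhs_proper J0)).
  apply: (@eq_has_deriv_in _ _ _ (fun=> c)) => //; last exact: has_deriv_in_cst.
  by move=> h Jh; rewrite fc.
have XV : X \in unitmx by exact: posdefmx_unit.
have UV : U \in unitmx by exact: posdefmx_unit.
have rhoE t : I t -> deriv_in I (rho (sigma 0)) t = - (A^T *m rho (sigma 0) t) /\
    B^T *m rho (sigma 0) t = 0.
  move=> It; have [zE vE _] := pdeE t 0 It J0.
  move: zE vE; have [-> ->] := zv t 0 It J0.
  rewrite /= !mulKmx// !subrr !subr0.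
  rewrite [dtau_z _ _ _](cst0 _ _ (sz st t)); last first.
    by move=> h Jh; have [] := zv t h It Jh.
  rewrite [dtau_v _ _ _](cst0 _ _ (sv st t)); last first.
    by move=> h Jh; have [] := zv t h It Jh.
  move=> zE vE; split.
    by apply/eqP; rewrite -addr_eq0 -oppr_eq0 opprD -zE.
  by apply/eqP; rewrite -oppr_eq0 -vE.
have rho_d t : I t -> has_deriv_in I (rho (sigma 0)) t (- (A^T *m rho (sigma 0) t)).
  move=> It; have [<- _] := rhoE t It.
  by rewrite dHdr_derivE//; exact: dHdr_deriv.
(* Induction on [j]: the expression vanishes on the whole interval, so its t-derivative does too,
   and differentiating [rho] produces one more factor [- A^T]. *)
have BA j t : I t -> B^T *m (A^T ^+ j *m rho (sigma 0) t) = 0.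
  elim: j t => [|j IHj] t It.
    by rewrite expr0 mul1mx; have [] := rhoE t It.
  have := has_deriv_in_mulmxr B^T (has_deriv_in_mulmxr (A^T ^+ j) (rho_d t It)).
  move=> /(has_deriv_in_unique (time_dnbhs_proper T_gt0 It)).
  rewrite (has_deriv_in_unique (time_dnbhs_proper T_gt0 It) (_ : has_deriv_in _ _ _ 0)).
    rewrite !mulmxN => /esym/eqP; rewrite oppr_eq0 => /eqP.
    by rewrite exprSr -[A^T ^+ j * A^T]/(A^T ^+ j *m A^T) -mulmxA.
  apply: (@eq_has_deriv_in _ _ _ (fun=> 0)) => //; last exact: has_deriv_in_cst.
  by move=> s Is; rewrite IHj.
move=> t It; apply/eqP; rewrite -subr_eq0; apply/eqP.
rewrite -[LHS](mulKVmx (posdefmx_unit P_pos)) -[invmx P *m _]/(rho (sigma 0) t).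
by rewrite (@controllable_eq0 _ _ _ A B (rho (sigma 0) t))// ?mulmx0// => j; exact: BA.
Qed.

End Trajectory.

End Dynamics.

Theorem proposition3p2 (R : realType) (n m : nat) (T : R)
  (A : 'M[R]_n) (B : 'M[R]_(n, m)) (x0 : 'cV[R]_n)
  (K : 'cV[R]_n * 'cV[R]_m -> R)
  (X : 'M[R]_n) (U : 'M[R]_m) (P : 'M[R]_n)
  (xs : R -> 'cV[R]_n) (us : R -> 'cV[R]_m) (ps : R -> 'cV[R]_n)
  (T_gt0 : 0 < T)
  (K_convex : strictly_convex K)
  (K_diff : forall q, differentiable K q)
  (X_pos : posdefmx X) (U_pos : posdefmx U) (P_pos : posdefmx P)
  (xup_opt : pontryagin T A B x0 K xs us ps)
  (AB_ctrl : controllable A B) :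
  largest_invariant_in T A B x0 K X U P xs us ps
    (stationary_set T A B x0 K X U P xs us ps)
    [set s | eq_state T s (star X U P xs us ps)].
Proof.
have star_sol := star_solution T_gt0 K_convex K_diff X_pos U_pos P_pos xup_opt.
set st := star X U P xs us ps in star_sol *.
have eq_state_sym s s' : eq_state T s s' -> eq_state T s' s.
  by move=> ss' t It; have [-> -> ->] := ss' t It.
split.
- move=> s /= s_st; split; first by exists (fun=> st) => //; exact: eq_state_sym.
  move=> sigma sigma_sol sigma0 tau Jtau.
  apply: (Htilde_eq0 T_gt0 K_convex K_diff X_pos U_pos P_pos xup_opt sigma_sol Jtau).
  apply: (le_trans (Htilde_le T_gt0 K_convex K_diff X_pos U_pos P_pos xup_opt
    sigma_sol Jtau)).
  have H0 t : [set t | 0 <= t <= T] t -> [/\ sz (sigma 0) t = sz st t,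
      sv (sigma 0) t = sv st t & sr (sigma 0) t = sr st t].
    by move=> It; have [-> -> ->] := sigma0 t It; exact: s_st.
  rewrite /Htilde (@eq_Rintegral _ _ _ _ _ (fun=> 0)); last first.
    move=> t; rewrite inE => /H0[-> -> ->].
    by rewrite !subrr /qform !mulmx0 !mxE !addr0.
  by rewrite Rintegral_cst ?mul0r ?mulr0//; exact: measurable_time.
- move=> s /= s_st; exists (fun=> st), 0; split => //=.
  + exact: eq_state_sym.
  + exact: has_deriv_in_derivable (has_deriv_in_cst _ _ _).
  + apply: (has_deriv_in_unique _ (has_deriv_in_cst _ _ _)).
    by apply: tau_dnbhs_proper => /=.
- move=> M M_inv M_stat s Ms.
  (* The solution witnessing stationarity may differ from one state to another, but the conclusion
     on [z] and [v] concerns the state alone. *)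
  have M_zv s' : M s' -> forall t, [set t | 0 <= t <= T] t ->
      sz s' t = sz st t /\ sv s' t = sv st t.
    move=> /M_stat[sigma [tau [sigma_sol Jtau sE _ dH0]]] t It.
    have [<- <- _] := sE t It.
    exact: (stationary_zv T_gt0 K_convex K_diff X_pos U_pos P_pos xup_opt
      sigma_sol Jtau dH0).
  (* Invariance gives a single solution from [s] that stays in [M], so [z] and [v] are optimal along
     all of it and [stationary_r] applies. *)
  have [[sigma sigma_sol sigma0] M_orbit] := M_inv s Ms.
  have r_st : forall t, [set t | 0 <= t <= T] t -> sr (sigma 0) t = sr st t.
    apply: (stationary_r T_gt0 X_pos U_pos P_pos xup_opt sigma_sol AB_ctrl).
    by move=> t tau It Jtau; apply: M_zv => //; exact: M_orbit.
  move=> t It; have [_ _ <-] := sigma0 t It.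
  by have [-> ->] := M_zv s Ms t It; rewrite r_st.
Qed.
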